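(* Let $\mathbb{K}$ be a field and let $v_X:X\to BS^1$ and $v_Y:Y\to BS^1$ be spaces over $BS^1$, where $X$ and $Y$ are connected and $H^*(X;\mathbb{K})$, $H^*(Y;\mathbb{K})$ are of finite total dimension. Assume further that $H^*(X;\mathbb{K})\not\cong\mathbb{K}$ and $H^*(Y;\mathbb{K})\not\cong\mathbb{K}$. Then for $k=0$ and $1$, $$d^k_{\mathrm{CohI},\mathbb{K}}(X,Y)\ge\frac12\bigl|\mathrm{cup}^k(v_X)_{\mathbb{K}}-\mathrm{cup}^k(v_Y)_{\mathbb{K}}\bigr|.$$
   Context: $BS^1$ is the classifying space of the circle group, $H^*(BS^1;\mathbb{K})\cong\mathbb{K}[u]$ with $\deg u=2$. For $v:X\to BS^1$ and $k\in\{0,1\}$, let $s^kH^*(X;\mathbb{K})$ be the graded $\mathbb{K}[t]$-module ($\deg t=1$) whose degree $i$ part is $H^{2i+k}(X;\mathbb{K})$, with $t$ acting by multiplication by $v^*(u)$. $\mathrm{cup}^k(v)_{\mathbb{K}}$ is the greatest non-negative integer $n$ such that the action of $t^n$ on $s^kH^*(X;\mathbb{K})$ is non-zero, and $\mathrm{cup}^k(v)_{\mathbb{K}}=-1$ if $s^kH^*(X;\mathbb{K})=0$. Let $\nu^k(X)$ be the functor from the poset $(\mathbb{R},\leq)$ to $\mathbb{K}$-vector spaces $r\mapsto H^{k+2\lfloor r\rfloor}(X;\mathbb{K})$, with structure maps for $r\le s$ given by multiplication by $v^*(u)^{\lfloor s\rfloor-\lfloor r\rfloor}$. Then $d^k_{\mathrm{CohI},\mathbb{K}}(X,Y)=d_{\mathrm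 I}(\nu^k(X),\nu^k(Y))$, where $d_{\mathrm I}$ is the interleaving distance: with $F^{\varepsilon}(a)=F(a+\varepsilon)$, $F,G$ are $\varepsilon$-interleaved if there are natural transformations $\varphi:F\to G^{\varepsilon}$, $\psi:G\to F^{\varepsilon}$ with $\psi^{\varepsilon}\varphi$ and $\varphi^{\varepsilon}\psi$ equal to the structure transformations $F\to F^{2\varepsilon}$, $G\to G^{2\varepsilon}$; $d_{\mathrm I}(F,G)$ is the infimum in $[0,\infty]$ of such $\varepsilon\ge0$. *)

(* Defs.v *)
From HB Require Import structures.
From mathcomp Require Import all_boot all_order all_algebra.
From mathcomp Require Import generic_quotient ring_quotient.
From mathcomp Require Import all_classical all_reals all_analysis.
From mathcomp Require Import complex zify ring.

Set Implicit Arguments.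
Unset Strict Implicit.
Unset Printing Implicit Defensive.

Import Order.TTheory GRing.Theory Num.Theory.
Import numFieldTopology.Exports.

Local Open Scope classical_set_scope.
Local Open Scope ring_scope.
Local Open Scope quotient_scope.

Record subspace (K : fieldType) (V : lmodType K) := Subspace {
  subspace_pred :> {pred V};
  subspace_closed : submod_closed subspace_pred
}.

HB.instance Definition _ (K : fieldType) (V : lmodType K) (I : subspace V) :=
  GRing.isSubmodClosed.Build K V (subspace_pred I) (subspace_closed I).

Section LmodQuotient.
Variables (K : fieldType) (V : lmodType K) (I : subspace V).

Definition lquot : Type := Quotient.quot (subspace_pred I).
HB.instance Definition _ := GRing.Zmodule.on lquot.

Definition lpi (x : V) : lquot := \pi_(Quotient.quot (subspace_pred I)) x.
Definition lrepr (a : lquot) : V := repr (a : Quotient.quot (subspace_pred I)).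

Lemma lreprK a : lpi (lrepr a) = a.
Proof. exact: reprK. Qed.

Lemma lpiP x y : lpi x = lpi y <-> x - y \in I.
Proof. by rewrite /lpi Quotient.idealrBE; split=> [->|/eqP]. Qed.

Lemma lpiD x y : lpi (x + y) = lpi x + lpi y.
Proof. exact: Quotient.pi_add. Qed.

Definition lquot_scale (c : K) (a : lquot) : lquot := lpi (c *: lrepr a).

Lemma lquot_scale_pi c x : lquot_scale c (lpi x) = lpi (c *: x).
Proof.
by apply/lpiP; rewrite -scalerBr rpredZ //; apply/lpiP; rewrite lreprK.
Qed.

Fact lquot_scaleA c1 c2 a :
  lquot_scale c1 (lquot_scale c2 a) = lquot_scale (c1 * c2) a.
Proof. by rewrite -[a]lreprK !lquot_scale_pi scalerA. Qed.

Fact lquot_scale1 : left_id 1 lquot_scale.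
Proof. by move=> a; rewrite -[a]lreprK lquot_scale_pi scale1r. Qed.

Fact lquot_scaleDr : right_distributive lquot_scale +%R.
Proof.
move=> c a b; rewrite -[a]lreprK -[b]lreprK -lpiD !lquot_scale_pi.
by rewrite scalerDr lpiD.
Qed.

Fact lquot_scaleDl a : {morph lquot_scale^~ a : c d / c + d}.
Proof.
by move=> c d; rewrite -[a]lreprK !lquot_scale_pi scalerDl lpiD.
Qed.

HB.instance Definition _ := GRing.Zmodule_isLmodule.Build K lquot
  lquot_scaleA lquot_scale1 lquot_scaleDr lquot_scaleDl.

End LmodQuotient.

Section LmodQuotientMap.
Variables (K : fieldType) (V W : lmodType K).
Variables (I : subspace V) (J : subspace W) (f : {linear V -> W}).
Hypothesis fIJ : forall x, x \in I -> f x \in J.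

Definition lquot_fun (a : lquot I) : lquot J := lpi J (f (lrepr a)).

Lemma lquot_fun_pi x : lquot_fun (lpi I x) = lpi J (f x).
Proof. by apply/lpiP; rewrite -linearB fIJ //; apply/lpiP; rewrite lreprK. Qed.

Fact lquot_fun_linear : linear lquot_fun.
Proof.
move=> c a b; rewrite -[a]lreprK -[b]lreprK.
rewrite [c *: lpi I _]lquot_scale_pi -lpiD !lquot_fun_pi linearP lpiD.
by congr (_ + _); rewrite [RHS]lquot_scale_pi.
Qed.

HB.instance Definition _ := GRing.isLinear.Build K (lquot I) (lquot J) _
  lquot_fun lquot_fun_linear.

Definition lquot_map : {linear lquot I -> lquot J} := lquot_fun.

End LmodQuotientMap.
Arguments lquot_map {K V W I J f} fIJ.

Section Simplices.
Variable R : realType.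

Definition std_simplex (n : nat) : set 'rV[R]_n.+1 :=
  [set x | (forall i, 0 <= x 0 i) /\ \sum_i x 0 i = 1].
Arguments std_simplex n : clear implicits.

Section SimplexMap.
Variables (m n : nat) (alpha : 'I_m.+1 -> 'I_n.+1).

(* the affine map sending the i-th vertex to the (alpha i)-th one *)
Definition simplex_row (x : 'rV[R]_m.+1) : 'rV[R]_n.+1 :=
  \row_j \sum_(i | alpha i == j) x 0 i.

Fact simplex_row_subproof (x : std_simplex m) :
  simplex_row (\val x) \in std_simplex n.
Proof.
case: x => x /= /set_mem[x0 x1]; apply/mem_set; split.
  by move=> j; rewrite mxE; apply: sumr_ge0.
rewrite -x1 [RHS](partition_big alpha predT) //=.
by apply: eq_bigr => j _; rewrite mxE.
Qed.

Definition simplex_map (x : std_simplex m) : std_simplex n :=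
  exist _ (simplex_row (\val x)) (simplex_row_subproof x).

Fact simplex_row_continuous : continuous simplex_row.
Proof.
move=> x A [P Px PA]; suff : \forall y \near x, forall j, P 0 j (simplex_row y 0 j).
  by apply: filterS => y Py; apply: PA => i j; rewrite ord1.
apply: (@filter_forall _ _ (fun j y => P 0 j (simplex_row y 0 j)) _
  (nbhs_filter x)) => j.
have cj : continuous (fun y : 'rV[R]_m.+1 => \sum_(i | alpha i == j) y 0 i).
  by apply: continuous_big => [|k _]; [exact: add_continuous
    | exact: coord_continuous].
have := Px 0 j; rewrite mxE => Px'.
have := cj x _ Px'; rewrite nbhs_simpl /=.
by apply: (@filterS _ _ (nbhs_filter x)) => y /=; rewrite mxE.
Qed.

Fact simplex_map_continuous : continuous simplex_map.
Proof.
apply: continuous_comp_initial.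
have -> : set_val \o simplex_map = simplex_row \o set_val by [].
move=> x; apply: continuous_comp; last exact: simplex_row_continuous.
exact: initial_continuous.
Qed.

HB.instance Definition _ := @isContinuous.Build (std_simplex m) (std_simplex n)
  simplex_map simplex_map_continuous.

End SimplexMap.

Lemma simplex_map_comp m n p (a : 'I_m.+1 -> 'I_n.+1) (b : 'I_n.+1 -> 'I_p.+1) x :
  simplex_map b (simplex_map a x) = simplex_map (b \o a) x.
Proof.
apply/val_inj/rowP => j; rewrite !mxE /=.
rewrite [RHS](partition_big a (fun i => b i == j)) //=.
apply: eq_bigr => i /eqP bij; rewrite mxE; apply: eq_bigl => l.
by case: eqP => [->|]; rewrite ?bij ?eqxx ?andbF.
Qed.

Variable X : topologicalType.

Definition simplex (n : nat) := continuousType (std_simplex n) X.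

Definition srestrict m n (s : simplex n) (alpha : 'I_m.+1 -> 'I_n.+1) : simplex m :=
  s \o simplex_map alpha.

Lemma srestrict_comp m n p (s : simplex p) (b : 'I_n.+1 -> 'I_p.+1)
    (a : 'I_m.+1 -> 'I_n.+1) (c : 'I_m.+1 -> 'I_p.+1) :
  b \o a =1 c -> srestrict (srestrict s b) a = srestrict s c.
Proof.
move=> /funext <-; apply/continuousEP => x /=.
by rewrite simplex_map_comp.
Qed.

Lemma srestrict_comp2 m n n' p (s : simplex p) (b : 'I_n.+1 -> 'I_p.+1)
    (a : 'I_m.+1 -> 'I_n.+1) (b' : 'I_n'.+1 -> 'I_p.+1) (a' : 'I_m.+1 -> 'I_n'.+1) :
  b \o a =1 b' \o a' -> srestrict (srestrict s b) a = srestrict (srestrict s b') a'.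
Proof. by move=> /srestrict_comp ->; apply/esym/srestrict_comp. Qed.

End Simplices.

Section Cochains.
Variables (R : realType) (K : fieldType) (X : topologicalType).

Definition cochain (n : nat) : Type := simplex R X n -> K^o.
HB.instance Definition _ n := GRing.Lmodule.on (cochain n).

Lemma cochainP n (c : K) (f g : cochain n) s :
  (c *: f + g) s = c * f s + g s.
Proof. by []. Qed.

Definition coboundary n (f : cochain n) : cochain n.+1 :=
  fun s => \sum_(i < n.+2) (-1) ^+ i * f (srestrict s (lift i)).

Fact coboundary_linear n : linear (@coboundary n).
Proof.
move=> c f g; apply/funext => s; rewrite /coboundary.
rewrite [RHS]cochainP mulr_sumr -big_split; apply: eq_bigr => i _ /=.
by rewrite cochainP mulrDr mulrCA.
Qed.

HB.instance Definition _ n := GRing.isLinear.Build K (cochain n)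
  (cochain n.+1) _ (@coboundary n) (@coboundary_linear n).

Definition cocycle_pred n : {pred cochain n} := [pred f | coboundary f == 0].

Fact cocycle_submod n : submod_closed (@cocycle_pred n).
Proof.
split=> [|c f g]; rewrite !inE ?linear0 // => df dg.
by rewrite linearP /= df dg scaler0 addr0.
Qed.

HB.instance Definition _ n := GRing.isSubmodClosed.Build K (cochain n)
  (@cocycle_pred n) (@cocycle_submod n).

Definition cocycle n : Type := {f : cochain n | f \in @cocycle_pred n}.
HB.instance Definition _ n := SubType.on (cocycle n).
HB.instance Definition _ n := [Choice of cocycle n by <:].
HB.instance Definition _ n := [SubChoice_isSubLmodule of cocycle n by <:].

Definition is_coboundary n : set (cochain n) :=
  match n with 0 => [set 0] | m.+1 => range (@coboundary m) end.

Definition coboundary_pred n : {pred cocycle n} :=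
  [pred z | `[< is_coboundary (val z) >]].

Fact coboundary_submod n : submod_closed (@coboundary_pred n).
Proof.
split=> [|c f g]; rewrite !inE.
  by case: n => [|n] //=; exists 0; rewrite ?linear0.
case: n f g => [|n] f g /=; first by move=> -> ->; rewrite scaler0 addr0.
by move=> [f' _ <-] [g' _ <-]; exists (c *: f' + g') => //; rewrite linearP.
Qed.

Definition coboundaries n : subspace (cocycle n) :=
  Subspace (@coboundary_submod n).

Definition cohomology n := lquot (coboundaries n).
HB.instance Definition _ n := GRing.Lmodule.on (cohomology n).

Fact unit_cocycle_subproof : ((fun=> 1) : cochain 0) \in @cocycle_pred 0.
Proof.
apply/eqP/funext => s; rewrite /coboundary.
by rewrite !big_ord_recl big_ord0 /= !expr0 expr1 !mulr1 addr0 subrr.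
Qed.

Definition unit_cocycle : cocycle 0 := exist _ (fun=> 1) unit_cocycle_subproof.

Definition cohomology1 : cohomology 0 := lpi (coboundaries 0) unit_cocycle.

Definition front p q (i : 'I_p.+1) : 'I_(p + q).+1 := inord i.
Definition back p q (i : 'I_q.+1) : 'I_(p + q).+1 := inord (p + i).

Lemma frontE p q (i : 'I_p.+1) : front q i = i :> nat.
Proof. by rewrite inordK //; have := ltn_ord i; lia. Qed.

Lemma backE p q (i : 'I_q.+1) : back p i = (p + i)%N :> nat.
Proof. by rewrite inordK //; have := ltn_ord i; lia. Qed.

Definition cup_cochain p q (f : cochain p) (g : cochain q) : cochain (p + q) :=
  fun s => f (srestrict s (@front p q)) * g (srestrict s (@back p q)).

Fact cup_cochain_linear p q (f : cochain p) : linear (@cup_cochain p q f).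
Proof.
move=> c g h; apply/funext => s; rewrite /cup_cochain.
by rewrite [RHS]cochainP cochainP mulrDr mulrCA.
Qed.

HB.instance Definition _ p q f := GRing.isLinear.Build K (cochain q)
  (cochain (p + q)) _ (@cup_cochain p q f) (@cup_cochain_linear p q f).

Lemma coboundary_cup2 q (f : cochain 2) (g : cochain q) :
  coboundary f = 0 ->
  coboundary (cup_cochain f g) = cup_cochain f (coboundary g).
Proof.
move=> df; apply/funext => s; rewrite [RHS]/cup_cochain.
set rho := srestrict s (@back 2 q.+1); set sigma := srestrict s (@front 2 q.+1).
pose tau : simplex R X 3 := srestrict s (fun i : 'I_4 => inord i : 'I_q.+4).
have front_lo (i : 'I_q.+4) (j : 'I_4) : i = j :> nat -> (i < 3)%N ->
    srestrict (srestrict s (lift i)) (@front 2 q) = srestrict tau (lift j).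
  move=> ij i3; apply: srestrict_comp2 => l; apply/val_inj => /=.
  by have l3 := ltn_ord l; rewrite ?(@frontE 2 q) ?(@frontE 2 q.+1) inordK /bump; lia.
have back_lo (i : 'I_q.+4) : (i < 3)%N ->
    srestrict (srestrict s (lift i)) (@back 2 q) = srestrict rho (lift ord0).
  move=> i3; apply: srestrict_comp2 => l; apply/val_inj => /=.
  by have l3 := ltn_ord l; rewrite (@backE 2 q) (@backE 2 q.+1) /= /bump; lia.
have front_hi (i : 'I_q.+4) : (2 < i)%N ->
    srestrict (srestrict s (lift i)) (@front 2 q) = sigma.
  move=> i3; apply: srestrict_comp => l; apply/val_inj => /=.
  by have l3 := ltn_ord l; rewrite (@frontE 2 q) (@frontE 2 q.+1) /bump; lia.
have tau_hi : srestrict tau (lift ord_max) = sigma.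
  apply: srestrict_comp => l; apply/val_inj => /=.
  by have l3 := ltn_ord l; rewrite ?(@frontE 2 q) ?(@frontE 2 q.+1) inordK /bump; lia.
have back_hi (i : 'I_q.+4) (j : 'I_q.+2) : i = j.+2 :> nat -> (0 < j)%N ->
    srestrict (srestrict s (lift i)) (@back 2 q) = srestrict rho (lift j).
  move=> ij j0; apply: srestrict_comp2 => l; apply/val_inj => /=.
  by have l3 := ltn_ord l; rewrite (@backE 2 q) (@backE 2 q.+1) /= /bump; lia.
have := congr1 (fun h : cochain 3 => h tau) df.
rewrite /coboundary !big_ord_recl big_ord0 addr0 /= => /eqP.
rewrite !addrA addr_eq0 => /eqP dftau.
have ord3 : lift ord0 (lift ord0 (lift ord0 ord0)) = ord_max :> 'I_4.
  exact: val_inj.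
rewrite ord3 tau_hi in dftau.
rewrite /cup_cochain (front_lo _ ord0) // (front_lo _ (lift ord0 ord0)) //.
rewrite (front_lo _ (lift ord0 (lift ord0 ord0))) // back_lo // back_lo //.
rewrite back_lo // front_hi //.
rewrite (back_hi _ (lift ord0 ord0)) // !mulrA -!mulrDl dftau.
rewrite [RHS]mulrDr mulr_sumr [in RHS]mulrDr.
congr (_ + _ + _).
- by rewrite /bump /= -signr_odd /= expr0 expr1; ring.
- by rewrite /bump /= -signr_odd /= expr1; ring.
- apply: eq_bigr => i _; rewrite front_hi //.
  by rewrite (back_hi _ (lift ord0 (lift ord0 i))) // /bump !add1n !exprS; ring.
Qed.

Section CupLeft.
Variables (u : cocycle 2) (n : nat).

Fact cup2_cocycle_subproof (z : cocycle n) :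
  (cup_cochain (val u) (val z) : cochain n.+2) \in @cocycle_pred n.+2.
Proof.
apply/eqP; rewrite [LHS]coboundary_cup2; last exact/eqP/(valP u).
by rewrite (eqP (valP z)) linear0.
Qed.

Definition cup2_cocycle (z : cocycle n) : cocycle n.+2 :=
  exist _ (cup_cochain (val u) (val z) : cochain n.+2) (cup2_cocycle_subproof z).

Fact cup2_cocycle_linear : linear cup2_cocycle.
Proof. by move=> c y z; apply/val_inj; rewrite /= !linearP. Qed.

HB.instance Definition _ := GRing.isLinear.Build K (cocycle n)
  (cocycle n.+2) _ cup2_cocycle cup2_cocycle_linear.

Fact cup2_coboundary (z : cocycle n) :
  z \in coboundaries n -> cup2_cocycle z \in coboundaries n.+2.
Proof.
move=> /asboolP zB; apply/asboolP => /=.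
case: n z zB => [|m] z /=.
  by move=> ->; exists 0 => //; rewrite !linear0.
move=> [g _ <-]; exists (cup_cochain (val u) g) => //.
by rewrite [LHS]coboundary_cup2 //; apply/eqP/(valP u).
Qed.

End CupLeft.

(* [cup2 u x] is the product of the classes u and x; by the Leibniz rule it
   does not depend on the cocycle chosen to represent u *)
Definition cup2 (u : cohomology 2) (n : nat) :
    {linear cohomology n -> cohomology n.+2} :=
  lquot_map (@cup2_coboundary (lrepr u) n).

Fixpoint cup2_exp (u : cohomology 2) (n : nat) : cohomology n.*2 :=
  match n with
  | 0 => cohomology1
  | m.+1 => cup2 u m.*2 (cup2_exp u m)
  end.

(* K[u] -> H^*(X; K), with u of degree 2, is an isomorphism *)
Definition polynomial_on (u : cohomology 2) :=
  (forall n (x : cohomology n.*2), exists! a : K, x = a *: cup2_exp u n) /\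
  (forall n (x : cohomology n.*2.+1), x = 0).

End Cochains.

Section Pullback.
Variables (R : realType) (K : fieldType) (X Y : topologicalType).
Variables (v : continuousType X Y) (n : nat).

Definition push_simplex m (s : simplex R X m) : simplex R Y m := v \o s.

Definition pull_cochain m (f : cochain R K Y m) : cochain R K X m :=
  fun s => f (push_simplex s).

Fact pull_cochain_linear m : linear (@pull_cochain m).
Proof. by []. Qed.

HB.instance Definition _ m := GRing.isLinear.Build K (cochain R K Y m)
  (cochain R K X m) _ (@pull_cochain m) (@pull_cochain_linear m).

Lemma coboundary_pull m (f : cochain R K Y m) :
  coboundary (pull_cochain f) = pull_cochain (coboundary f).
Proof.
apply/funext => s; apply: eq_bigr => i _; congr (_ * f _).
exact/continuousEP.
Qed.

Fact pull_cocycle_subproof (z : cocycle R K Y n) :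
  pull_cochain (val z) \in @cocycle_pred R K X n.
Proof.
by apply/eqP; rewrite [LHS]coboundary_pull (eqP (valP z)) linear0.
Qed.

Definition pull_cocycle (z : cocycle R K Y n) : cocycle R K X n :=
  exist _ (pull_cochain (val z)) (pull_cocycle_subproof z).

Fact pull_cocycle_linear : linear pull_cocycle.
Proof. by move=> c y z; apply/val_inj. Qed.

HB.instance Definition _ := GRing.isLinear.Build K (cocycle R K Y n)
  (cocycle R K X n) _ pull_cocycle pull_cocycle_linear.

Fact pull_coboundaries (z : cocycle R K Y n) :
  z \in coboundaries R K Y n -> pull_cocycle z \in coboundaries R K X n.
Proof.
move=> /asboolP zB; apply/asboolP => /=.
case: n z zB => [|m] z /=; first by move=> ->; rewrite linear0.
by move=> [g _ <-]; exists (pull_cochain g) => //; rewrite [LHS]coboundary_pull.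
Qed.

Definition pullback : {linear cohomology R K Y n -> cohomology R K X n} :=
  lquot_map pull_coboundaries.

End Pullback.
Arguments pullback {R} K {X Y} v n.

Section Graded.
Variable K : fieldType.

Definition lmod_zero (V : lmodType K) := forall x : V, x = 0.

Definition has_dim (V : lmodType K) (d : nat) :=
  exists b : 'I_d -> V,
    forall x, exists! c : {ffun 'I_d -> K}, x = \sum_i c i *: b i.

Definition finite_total_dim (M : nat -> lmodType K) :=
  exists d : nat -> nat,
    (forall n, has_dim (M n) (d n)) /\ finite_set [set n | d n != 0].

Definition graded_iso (M N : nat -> lmodType K) :=
  exists f : forall n, {linear M n -> N n}, forall n, bijective (f n).

(* K concentrated in degree 0 *)
Definition graded_unit (n : nat) : lmodType K :=
  if n is 0 then K^o : lmodType K else 'rV[K]_0.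

(* graded modules over K[t], deg t = 1, concentrated in degrees >= 0 *)
Record gmodule := Gmodule {
  gpart :> nat -> lmodType K;
  gact : forall i, {linear gpart i -> gpart i.+1}
}.

Variable M : gmodule.

Fixpoint gexp (i n : nat) : {linear M i -> M (n + i)} :=
  match n with
  | 0 => idfun
  | m.+1 => gact M (m + i) \o gexp i m
  end.

Definition gexp_nonzero (n : nat) := exists i, exists x : M i, gexp i n x != 0.

(* c is the greatest n such that t^n acts non-trivially, or -1 when M = 0;
   gcup M is meaningful only if such a c exists, e.g. if M is of finite total
   dimension *)
Definition is_gcup (c : int) :=
  (c = -1 /\ forall i, lmod_zero (M i)) \/
  exists n : nat, [/\ c = n, gexp_nonzero n &
                      forall m, gexp_nonzero m -> (m <= n)%N].

Definition gcup : int := xget 0 is_gcup.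

End Graded.

Section Persistence.
Variables (R : realType) (K : fieldType).

Record pmodule := Pmodule {
  pobj :> R -> lmodType K;
  pmap : forall a b, a <= b -> {linear pobj a -> pobj b};
  pmap_id : forall a (h : a <= a) x, pmap h x = x;
  pmap_comp : forall a b c (hab : a <= b) (hbc : b <= c) (hac : a <= c) x,
    pmap hbc (pmap hab x) = pmap hac x
}.

Record phom (F G : pmodule) := Phom {
  phom_map :> forall a, {linear F a -> G a};
  phom_natural : forall a b (h : a <= b) x,
    phom_map b (pmap F h x) = pmap G h (phom_map a x)
}.

Section Shift.
Variables (F : pmodule) (e : R).

Fact shift_le a b : a <= b -> a + e <= b + e.
Proof. by rewrite lerD2r. Qed.

Definition pshift : pmodule := {|
  pobj := fun a => F (a + e);
  pmap := fun a b h => pmap F (shift_le h);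
  pmap_id := fun a h x => pmap_id (shift_le h) x;
  pmap_comp := fun a b c hab hbc hac x =>
    pmap_comp (shift_le hab) (shift_le hbc) (shift_le hac) x
|}.

End Shift.

(* the structure transformation F -> F^(2e) is written with a + e + e in place
   of a + 2 e, so that no cast is needed *)
Definition interleaved (e : R) (F G : pmodule) :=
  exists (phi : phom F (pshift G e)) (psi : phom G (pshift F e)),
    (forall a (h : a <= a + e + e) x, psi (a + e) (phi a x) = pmap F h x) /\
    (forall a (h : a <= a + e + e) x, phi (a + e) (psi a x) = pmap G h x).

Definition interleaving_distance (F G : pmodule) : \bar R :=
  ereal_inf [set e%:E | e in [set e : R | 0 <= e /\ interleaved e F G]].

Section Floor.
Variable M : gmodule K.

Definition gcast i j (e : i = j) : {linear M i -> M j} :=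
  eq_rect i (fun j => {linear M i -> M j}) idfun j e.

(* multiplication by t ^+ (j - i); the zero map when j < i *)
Definition gmap (i j : nat) : {linear M i -> M j} :=
  match @idP (i <= j)%N with
  | ReflectT h => gcast (subnK h) \o gexp M i (j - i)
  | ReflectF _ => \0
  end.

Lemma gmapE i n j (e : (n + i)%N = j) x :
  gmap i j x = gcast e (gexp M i n x).
Proof.
rewrite /gmap; case: {-}_ / idP => [h|]; last by case: _ / e; rewrite leq_addl.
have en : (j - i)%N = n by lia.
move: (subnK h); rewrite /=; move: (j - i)%N en => m em; case: _ / (esym em).
by move=> e'; rewrite (eq_irrelevance e e').
Qed.

Lemma gmap_id i x : gmap i i x = x.
Proof. by rewrite (@gmapE i 0 i erefl). Qed.

Lemma gmap_comp i j k x : (i <= j <= k)%N -> gmap j k (gmap i j x) = gmap i k x.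
Proof.
move=> /andP[/subnK e1 /subnK e2]; move: (j - i)%N (k - j)%N e1 e2 => m n e1 e2.
have e3 : ((n + m) + i)%N = k by rewrite -addnA e1.
rewrite (gmapE e1) (gmapE e2) (gmapE e3).
case: _ / e1 e2 e3 => e2 e3; case: _ / e2 e3 => e3 /=.
elim: n e3 => [|n IHn] e3 /=; first by rewrite (eq_irrelevance e3 erefl).
rewrite (IHn (esym (addnA n m i))).
have gactC a b (e : a = b) (e' : a.+1 = b.+1) y :
    gact M b (gcast e y) = gcast e' (gact M a y).
  by case: _ / e e' => e'; rewrite (eq_irrelevance e' erefl).
exact: gactC.
Qed.

(* M extended by zero to negative degrees *)
Definition zpart (z : int) : lmodType K :=
  match z with Posz i => M i | Negz _ => 'rV[K]_0 end.

Definition zmap (z w : int) : {linear zpart z -> zpart w} :=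
  match z, w with
  | Posz i, Posz j => gmap i j
  | _, _ => \0
  end.

Lemma zmap_id z x : zmap z z x = x.
Proof. by case: z x => [i|i] x /=; [exact: gmap_id | rewrite [x]thinmx0]. Qed.

Lemma zmap_comp z w y x : z <= w -> w <= y ->
  zmap w y (zmap z w x) = zmap z y x.
Proof.
case: z x => [i|i] x; last by rewrite [x]thinmx0 !linear0.
case: w => [j|j] //; case: y => [k|k] // ij jk.
by apply: gmap_comp; rewrite -!lez_nat ij.
Qed.

Fact pfloor_id (a : R) (h : a <= a) x :
  zmap (Num.floor a) (Num.floor a) x = x.
Proof. exact: zmap_id. Qed.

Fact pfloor_comp (a b c : R) (hab : a <= b) (hbc : b <= c) (hac : a <= c) x :
  zmap (Num.floor b) (Num.floor c) (zmap (Num.floor a) (Num.floor b) x) =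
  zmap (Num.floor a) (Num.floor c) x.
Proof. by rewrite zmap_comp // le_floor. Qed.

Definition pfloor : pmodule := {|
  pobj := fun r => zpart (Num.floor r);
  pmap := fun r s _ => zmap (Num.floor r) (Num.floor s);
  pmap_id := pfloor_id;
  pmap_comp := pfloor_comp
|}.

End Floor.

End Persistence.

Section CPinf.
Variable R : realType.

Local Notation C := (R[i]^o).

(* C^oo minus 0, finitely supported sequences being encoded as polynomials *)
Definition Cinf_nz : Type := {p : {poly R[i]} | p != 0}.
HB.instance Definition _ := SubType.on Cinf_nz.
HB.instance Definition _ := [Choice of Cinf_nz by <:].

Definition same_line (p q : Cinf_nz) : bool :=
  `[< exists2 c : R[i], c != 0 & val q = c *: val p >].

Fact same_line_equiv : equiv_class_of same_line.
Proof.
split=> [p|p q|q p r].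
- by apply/asboolP; exists 1; rewrite ?oner_eq0 ?scale1r.
- by apply/asboolP/asboolP => -[c c0 ->]; exists c^-1;
    rewrite ?invr_eq0 // scalerA mulVf // scale1r.
- move=> /asboolP[c c0 ep] /asboolP[d d0 er]; apply/asboolP.
  by exists (d * c); rewrite ?mulf_neq0 // er ep scalerA.
Qed.

Canonical same_line_equivrel := EquivRelPack same_line_equiv.
Canonical same_line_encmodrel := defaultEncModRel same_line.

Definition CPinf : Type := {eq_quot same_line}.
HB.instance Definition _ := Choice.on CPinf.

Definition nonzero_vectors n : set 'rV[C]_n.+1 := [set z | z != 0].
Arguments nonzero_vectors n : clear implicits.

Fact vector_poly_subproof n (z : nonzero_vectors n) :
  (rVpoly (val z : 'rV[R[i]]_n.+1)) != 0.
Proof.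
case: z => z /= /set_mem /=; apply: contra_neq => z0.
by rewrite -[z]rVpolyK z0 linear0.
Qed.

Definition line n (z : nonzero_vectors n) : CPinf :=
  \pi_CPinf (exist (fun p => p != 0) _ (vector_poly_subproof z) : Cinf_nz).

(* CP^oo, our model of BS^1, is the colimit of the spaces
   CP^n = (C^(n+1) minus 0) / C^* *)
Definition CPinf_open (U : set CPinf) := forall n, open (@line n @^-1` U).

Fact CPinf_openT : CPinf_open setT.
Proof. by move=> n; rewrite preimage_setT; exact: openT. Qed.

Fact CPinf_openI : setI_closed CPinf_open.
Proof. by move=> U V oU oV n; rewrite preimage_setI; exact: openI. Qed.

Fact CPinf_open_bigcup (I : Type) (F : I -> set CPinf) :
  (forall i, CPinf_open (F i)) -> CPinf_open (\bigcup_i F i).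
Proof.
by move=> oF n; rewrite preimage_bigcup; apply: bigcup_open => i _; exact: oF.
Qed.

HB.instance Definition _ := isOpenTopological.Build CPinf
  CPinf_openT CPinf_openI CPinf_open_bigcup.

End CPinf.

Section SpacesOverBS1.
Variables (R : realType) (K : fieldType) (u : cohomology R K (CPinf R) 2).

Section OneSpace.
Variables (X : topologicalType) (v : continuousType X (CPinf R)) (k : nat).

(* the degree i part is H^(2i+k)(X; K); t acts by multiplication by v^*(u) *)
Definition shifted_cohomology : gmodule K := {|
  gpart := fun i => cohomology R K X (i.*2 + k);
  gact := fun i => cup2 (pullback K v 2 u) (i.*2 + k)
|}.

Definition cup_length : int := gcup shifted_cohomology.

(* r |-> H^(k + 2 floor r)(X; K); for k = 0, 1 the degree k + 2 floor r is
   negative, and the cohomology zero, exactly when floor r is negative *)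
Definition cohomology_pmodule : pmodule R K := pfloor R shifted_cohomology.

End OneSpace.

Definition dCohI (X Y : topologicalType) (vX : continuousType X (CPinf R))
    (vY : continuousType Y (CPinf R)) (k : nat) : \bar R :=
  interleaving_distance (cohomology_pmodule vX k) (cohomology_pmodule vY k).

End SpacesOverBS1.

(* Main.v *)
(** Let [t^n] act non-trivially on [M] and [t^p] act as zero on [N].  An
    [e]-interleaving of the associated persistence modules factors the structure
    map of [M] from degree [i] to degree [floor (b + 2 e)] through the structure
    map of [N] from [floor (i + e)] to [floor (b + e)].  Taking [b] as small as
    possible such that the latter is multiplication by at least [t^p], hence
    zero, forces [floor (b + 2 e)] to exceed [i + n], that is
    [n + 1 - p <= 2 e]. *)
Require Import Defs.
From mathcomp Require Import all_boot all_order all_algebra.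
From mathcomp Require Import all_classical all_reals all_analysis.
From mathcomp Require Import zify lra.

Set Implicit Arguments.
Unset Strict Implicit.
Unset Printing Implicit Defensive.

Import Order.TTheory GRing.Theory Num.Theory.
Import numFieldTopology.Exports.

Local Open Scope classical_set_scope.
Local Open Scope ring_scope.

Section GradedModules.
Variables (K : fieldType) (M : gmodule K).

Lemma gcast_eq0 i j (e : i = j) (x : M i) : (gcast M e x == 0) = (x == 0).
Proof. by case: _ / e. Qed.

Lemma gexp_nonzero_leq m n : (m <= n)%N -> gexp_nonzero M n -> gexp_nonzero M m.
Proof.
move=> /subnK <-; elim: (n - m)%N => [//|d IHd] [i [x ex]]; apply: IHd.
by exists i, x; apply: contraNneq ex => /= ->; rewrite linear0.
Qed.

(** Between non-negative degrees the map is multiplication by [t^(w - z)] with [w - z >= p], which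
    vanishes as soon as [t^p] does. *)
Lemma zmap_eq0 p z w (x : zpart M z) : ~ gexp_nonzero M p -> z + p%:Z <= w ->
  zmap M z w x = 0.
Proof.
move=> np; case: z x => [i|i] x //=; case: w => [j|j] //= ij.
have e : (j - i + i)%N = j by lia.
rewrite (gmapE e); apply/eqP; rewrite gcast_eq0; apply/negPn/negP => nz.
by apply: np; apply: (@gexp_nonzero_leq _ (j - i)%N); [lia | exists i, x].
Qed.

(** One [x] serves all targets, since [t^n x] factors through every intermediate degree. The
    equation [z = i] lets [floor a] stand for [z] without a cast. *)
Lemma gexp_nonzero_zmap n : gexp_nonzero M n -> exists i : nat,
  forall z, z = i%:Z -> exists x : zpart M z,
    forall w, z <= w -> w <= z + n%:Z -> zmap M z w x != 0.
Proof.
move=> [i [x nz]]; exists i => _ ->; exists x => -[j|//] ij jn.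
apply: contra_neq nz => xj.
have -> : gexp M i n x = gmap M i (n + i) x by rewrite (gmapE (erefl _)).
by rewrite -(@gmap_comp _ _ _ j) ?[gmap _ _ _ x]xj ?linear0 //; lia.
Qed.

(** The exponents of non-trivial powers form an initial segment, empty when [c = -1]. *)
Lemma is_gcup_gexp_nonzero c n : is_gcup M c -> gexp_nonzero M n <-> n%:Z <= c.
Proof.
case=> [[-> M0]|[m [-> mM maxm]]].
  by split=> [[i [x]]|//]; rewrite [gexp _ _ _ _]M0 eqxx.
split=> [/maxm //|nm]; exact: gexp_nonzero_leq mM.
Qed.

Lemma is_gcup_geN1 c : is_gcup M c -> -1 <= c.
Proof. by case=> [[->]|[n [->]]]. Qed.

(** If [t^m] is non-zero on degree [i], then [m + i < d], so a greatest exponent exists. If no power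
    is non-zero, then neither is [t^0 = 1], and [M = 0]. *)
Lemma is_gcup_gcup d : (forall i, (d <= i)%N -> lmod_zero (M i)) ->
  is_gcup M (gcup M).
Proof.
move=> M0; apply: xgetPex.
have [[n0 nz0]|none] := pselect (exists n, gexp_nonzero M n); last first.
  exists (-1); left; split=> // i x; apply/eqP/negPn/negP => x0.
  by apply: none; exists 0%N, i, x.
have exP : exists n, `[< gexp_nonzero M n >] by exists n0; apply/asboolP.
have ubP n : `[< gexp_nonzero M n >] -> (n <= d)%N.
  move=> /asboolP[i [x]]; rewrite leqNgt; apply: contraNN => dn.
  by apply/eqP/M0; lia.
case: (ex_maxnP exP ubP) => n /asboolP nM maxn.
by exists n%:Z; right; exists n; split=> // m mM; apply: maxn; apply/asboolP.
Qed.

End GradedModules.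

Lemma finite_total_dim_vanish (K : fieldType) (M : nat -> lmodType K) :
  finite_total_dim M -> exists d, forall n, (d <= n)%N -> lmod_zero (M n).
Proof.
move=> [d [Md /finite_seqP[s ds]]]; exists (\max_(n <- s) n).+1 => n ltn x.
have dn : d n = 0%N.
  apply/eqP/negPn/negP => dn.
  have : [set n | d n != 0%N] n by [].
  rewrite ds /= => sn.
  by have := leq_bigmax_seq (P := xpredT) (F := id) n sn isT; rewrite leqNgt ltn.
have [b bP] := Md n; move: b bP; rewrite dn => b bP.
by have [c [-> _]] := bP x; rewrite big_ord0.
Qed.

Section Interleaving.
Variables (R : realType) (K : fieldType).

Lemma interleaved_sym (e : R) (F G : pmodule R K) :
  interleaved e F G -> interleaved e G F.
Proof. by move=> [phi [psi [h1 h2]]]; exists psi, phi. Qed.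

Lemma interleaved_pfloor_le (M N : gmodule K) (e : R) (n p : nat) : 0 <= e ->
  interleaved e (pfloor R M) (pfloor R N) ->
  gexp_nonzero M n -> ~ gexp_nonzero N p -> n.+1%:R - p%:R <= 2 * e.
Proof.
move=> e0 [phi [psi [psiphi _]]] /gexp_nonzero_zmap[i iP] Np.
rewrite leNgt; apply/negP => lt2e.
pose a : R := i%:R.
have fa : Num.floor a = i%:Z by rewrite /a -[i%:R]/(i%:Z%:~R) intrKfloor.
have [x xP] := iP _ fa.
have fae : (Num.floor (a + e))%:~R <= a + e by exact: floor_le.
(* the maximum only matters for [p = 0], where the second term may be below [a] *)
pose b : R := Num.max a ((Num.floor (a + e) + p%:Z)%:~R - e).
have hab : a <= b by rewrite le_max lexx.
have hbe : b <= b + e + e by lra.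
have hae : a <= b + e + e by lra.
(* Both candidates for [b] give [b + 2e < i + n + 1], so [x] should survive up to [b + 2e]; the
   contradiction is that its image there is zero. *)
have /xP/(_ _)/eqP[] : Num.floor a <= Num.floor (b + e + e) by exact: le_floor.
  rewrite fa -ltzD1 floor_lt_int !intrD /b.
  rewrite -!pmulrn -/a.
  move: lt2e (ler0n R p); rewrite -(natr1 n) => lt2e p0.
  by case: (leP a) => _; rewrite ?intrD -?pmulrn; lra.
rewrite -[LHS]/(Defs.pmap (pfloor R M) hae x) -(Defs.pmap_comp hab hbe) -psiphi.
rewrite phom_natural [X in psi _ X](_ : _ = 0) ?linear0 //.
(* The choice of [b] enters here: [b + e >= floor (a + e) + p]. *)
apply: zmap_eq0 Np _; rewrite floor_ge_int /b.
by rewrite -lerBlDr le_max lexx orbT.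
Qed.

Lemma interleaved_gcup_le (M N : gmodule K) (e : R) (c d : int) : 0 <= e ->
  interleaved e (pfloor R M) (pfloor R N) -> is_gcup M c -> is_gcup N d ->
  (c - d)%:~R <= 2 * e.
Proof.
move=> e0 MN Mc Nd.
have [cd|dc] := leP c d.
  by apply: (@le_trans _ _ 0); rewrite ?mulr_ge0 // lerz0 subr_le0.
have dN1 := is_gcup_geN1 Nd.
have [n cE] : exists n : nat, c = n%:Z by exists (absz c); lia.
(* [p = d + 1] is the least exponent whose power kills [N], also for [d = -1]; then
   [n + 1 - p = c - d]. *)
have [p dE] : exists p : nat, d = p%:Z - 1 by exists (absz (d + 1)); lia.
have Mn : gexp_nonzero M n by apply/(is_gcup_gexp_nonzero n Mc); lia.
have Np : ~ gexp_nonzero N p by move/(is_gcup_gexp_nonzero p Nd); lia.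
have := interleaved_pfloor_le e0 MN Mn Np; congr (_ <= _).
by rewrite cE dE !rmorphB /= -(natr1 n) -!pmulrn; lra.
Qed.

Lemma interleaving_distance_gcup (M N : gmodule K) (c d : int) :
  is_gcup M c -> is_gcup N d ->
  ((2^-1 * `|c%:~R - d%:~R|)%:E
     <= interleaving_distance (pfloor R M) (pfloor R N))%E.
Proof.
move=> Mc Nd; apply: le_ereal_inf_tmp => _ [e [e0 MN] <-]; rewrite lee_fin.
rewrite ler_pdivrMl // ler_norml -rmorphB /=.
(* The other sign follows by exchanging [M] and [N]. *)
rewrite (interleaved_gcup_le e0 MN Mc Nd) andbT lerNl -rmorphN /= opprB.
exact: interleaved_gcup_le e0 (interleaved_sym MN) Nd Mc.
Qed.

End Interleaving.

(** The degree [i] part sits in cohomological degree [2i + k >= i], so it vanishes for large [i]. *)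
Lemma is_gcup_cup_length (R : realType) (K : fieldType)
    (u : cohomology R K (CPinf R) 2) (X : topologicalType)
    (v : continuousType X (CPinf R)) (k : nat) :
  finite_total_dim (fun n => cohomology R K X n) ->
  is_gcup (shifted_cohomology u v k) (cup_length u v k).
Proof.
move=> /finite_total_dim_vanish[d dP]; apply: (is_gcup_gcup (d := d)) => i di.
by apply: dP; lia.
Qed.

Theorem proposition5p11 (R : realType) (K : fieldType)
    (u : cohomology R K (CPinf R) 2) (hu : polynomial_on u)
    (X Y : topologicalType)
    (vX : continuousType X (CPinf R)) (vY : continuousType Y (CPinf R))
    (connX : connected [set: X]) (connY : connected [set: Y])
    (finX : finite_total_dim (fun n => cohomology R K X n))
    (finY : finite_total_dim (fun n => cohomology R K Y n))
    (nontrivX : ~ graded_iso (fun n => cohomology R K X n) (@graded_unit K))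
    (nontrivY : ~ graded_iso (fun n => cohomology R K Y n) (@graded_unit K))
    (k : nat) (hk : (k < 2)%N) :
  ((2^-1 * `|(cup_length u vX k)%:~R - (cup_length u vY k)%:~R|)%:E
     <= dCohI u vX vY k)%E.
Proof.
by apply: interleaving_distance_gcup; exact: is_gcup_cup_length.
Qed.
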